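(* Suppose that $\Omega$ is a bounded, locally compact Polish space with metric $d$. Let $\mu$ and $\nu$ be Borel probability measures on $\Omega$. Then the supremum of integrals $$\int_{\Omega} g\, d(\mu-\nu)$$ taken over the set of $1$-Lipschitz functions $g\in\mathcal{C}(\Omega)$ is equal to the infimum of integrals $$\int_{\Omega \times \Omega} d\,d\pi$$ over all $\pi\in\Gamma(\mu,\nu)$, where $\Gamma(\mu,\nu)$ is the set of all Borel probability measures on $\Omega\times \Omega$ whose marginals are $\mu$ and $\nu$ respectively. Moreover, both the supremum and the infimum are attained.
   Context: $\mathcal{C}(\Omega)$ denotes the space of bounded continuous real functions on $\Omega$. ''$1$-Lipschitz'' and ''bounded'' are with respect to the metric $d$, which induces the topology of $\Omega$. *)

(* Defs.v *)
From HB Require Import structures.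
From mathcomp Require Import all_boot all_order all_algebra.
From mathcomp Require Import all_classical all_reals all_analysis.

Set Implicit Arguments.
Unset Strict Implicit.
Unset Printing Implicit Defensive.

Import Order.TTheory GRing.Theory Num.Theory.
Import numFieldNormedType.Exports.

Local Open Scope classical_set_scope.
Local Open Scope ring_scope.

(* The library's measurable types are pointed whereas metricType is not. The
   point only says that the space is nonempty, which any space carrying a
   probability measure is. *)
#[short(type="pmetricType")]
HB.structure Definition PointedMetric (K : numDomainType) :=
  {M of Pointed M & Metric K M}.

Notation borelType T := (g_sigma_algebraType (@open T)).

Definition separable (T : topologicalType) : Prop :=
  exists2 D : set T, countable D & dense D.

Definition complete_metric (R : realType) (M : metricType R) : Prop :=
  forall F : set_system M, ProperFilter F -> cauchy F -> exists x : M, F --> x.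

Definition homeomorphism (T U : topologicalType) (f : T -> U) : Prop :=
  continuous f /\
  exists g : U -> T, [/\ cancel f g, cancel g f & continuous g].

(* The complete metric is any one inducing the topology of T: when T is itself
   a metric space, its own metric need not be complete. *)
Definition completely_metrizable (R : realType) (T : topologicalType) : Prop :=
  exists2 M : metricType R,
    complete_metric M & exists f : T -> M, homeomorphism f.

Definition polish (R : realType) (T : topologicalType) : Prop :=
  separable T /\ completely_metrizable R T.

Definition bounded_space (R : realType) (T : metricType R) : Prop :=
  exists D : R, forall x y : T, mdist x y <= D.

Definition bounded_continuous (R : realType) (T : topologicalType)
    (g : T -> R) : Prop :=
  continuous g /\ [bounded g x | x in [set: T]].

(* The library's k.-lipschitz requires a normed module as domain. *)
Definition lipschitz1 (R : realType) (T : metricType R) (g : T -> R) : Prop :=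
  forall x y : T, `|g x - g y| <= mdist x y.

Definition couplings (R : realType) (T : pmetricType R)
    (mu nu : probability (borelType T) R) :
    set (probability (borelType (T * T)%type) R) :=
  [set pi | forall A : set (borelType T), measurable A ->
     pushforward pi (fst : borelType (T * T)%type -> borelType T) A = mu A /\
     pushforward pi (snd : borelType (T * T)%type -> borelType T) A = nu A].

(* The integral of g against mu - nu. For bounded continuous g both terms are
   finite, so the extended-real subtraction is the real one. *)
Definition integral_diff (R : realType) (T : pmetricType R)
    (mu nu : probability (borelType T) R) (g : T -> R) : \bar R :=
  (\int[mu]_x (g x)%:E - \int[nu]_x (g x)%:E)%E.

Definition transport_cost (R : realType) (T : pmetricType R)
    (pi : probability (borelType (T * T)%type) R) : \bar R :=
  (\int[pi]_z (mdist z.1 z.2)%:E)%E.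

(* Main.v *)
(* On bounded functions h on T x T, let p h be the infimum of the sums of the
   mu-integral of f and the nu-integral of g over all bounded Borel f, g with
   h (x, y) <= f x + g y. By Hahn-Banach there is a linear L <= p with
   L (- d) = p (- d); it is positive and has marginals mu and nu. As mu and nu
   are inner regular with respect to compact sets (T is sigma-compact),
   A x B |-> L 1_(A x B) is sigma-additive on Borel rectangles, hence extends to
   a coupling pi, and step functions show that the cost of pi is at most
   L d = - p (- d). Taking d-transforms shows that - p (- d) is at most the
   supremum over 1-Lipschitz functions, so weak duality gives equality and pi is
   optimal. For a fast maximising sequence of potentials, the eventual supremum
   u is 1-Lipschitz and saturates u x - u y <= d (x, y) pi-almost everywhere, so
   it is an optimal potential. *)

Require Import Defs.
From HB Require Import structures.
From mathcomp Require Import all_boot all_order all_algebra.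
From mathcomp Require Import all_classical all_reals all_analysis.
From mathcomp Require Import measurable_realfun lra.

Set Implicit Arguments.
Unset Strict Implicit.
Unset Printing Implicit Defensive.

Import Order.TTheory GRing.Theory Num.Theory.
Import numFieldNormedType.Exports.

Local Open Scope classical_set_scope.
Local Open Scope ring_scope.

(** * Linear functionals below a sublinear one *)

Section sublinear.
Context {R : realType} {V : lmodType R} (B : set V).
Hypothesis BD : forall x y, B x -> B y -> B (x + y).
Hypothesis BZ : forall t x, B x -> B (t *: x).

Definition sublinear (p : V -> R) :=
  (forall x y, B x -> B y -> p (x + y) <= p x + p y) /\
  (forall t x, 0 <= t -> B x -> p (t *: x) = t * p x).

Lemma sublinear0 p x : sublinear p -> B x -> p 0 = 0.
Proof. by move=> [_ pZ] Bx; rewrite -(scale0r x) pZ ?mul0r. Qed.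

(** The bound at [t^-1], applied to [t *: x], gives the reverse inequality; for [t = 0],
    subadditivity at [x + 0] gives [0 <= p 0]. *)
Lemma sublinear_le p : (forall x y, B x -> B y -> p (x + y) <= p x + p y) ->
  (forall t x, 0 <= t -> B x -> p (t *: x) <= t * p x) -> sublinear p.
Proof.
move=> pD pZ; split=> // t x t0 Bx; apply/eqP; rewrite eq_le pZ//=.
have [->|tn0] := eqVneq t 0.
  rewrite mul0r scale0r; have := pD _ _ Bx (BZ 0 Bx).
  by rewrite scale0r addr0; lra.
have ti0 : 0 <= t^-1 by rewrite invr_ge0.
have := pZ _ _ ti0 (BZ t Bx).
by rewrite scalerA mulVf// scale1r ler_pdivlMl// lt_neqAle eq_sym tn0.
Qed.

Lemma sublinear_ge p x : sublinear p -> B x -> - p (- x) <= p x.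
Proof.
move=> sp Bx; have BNx : B (- x) by rewrite -scaleN1r; exact: BZ.
by have := sp.1 _ _ Bx BNx; rewrite subrr (sublinear0 sp Bx); lra.
Qed.

(** Writing [t *: y] as the sum of [- x] and [x + t *: y] bounds the family below uniformly in [t];
    this makes the infimum in [sublinear_shift] finite. *)
Lemma sublinear_le_scale p x y t : sublinear p -> B x -> B y -> 0 <= t ->
  - p (- x) <= p (x + t *: y) - t * p y.
Proof.
move=> sp Bx By t0.
have BNx : B (- x) by rewrite -scaleN1r; exact: BZ.
have Bty := BZ t By.
have := sp.1 _ _ BNx (BD Bx Bty).
by rewrite addrA addNr add0r sp.2//; lra.
Qed.

(** For sublinear [p] this is the largest sublinear functional below [p] whose value at [- a] is at
    most [- p a]; a linear functional below it is therefore at least [p a] at [a]. *)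
Definition sublinear_shift (p : V -> R) (a x : V) : R :=
  inf [set p (x + t *: a) - t * p a | t in [set t | 0 <= t]].

Let shift_has_inf p a x : sublinear p -> B a -> B x ->
  has_inf [set p (x + t *: a) - t * p a | t in [set t | 0 <= t]].
Proof.
move=> sp Ba Bx; split; first by exists (p (x + 0 *: a) - 0 * p a), 0 => /=.
exists (- p (- x)) => _ [t /= t0 <-]; exact: sublinear_le_scale.
Qed.

Lemma sublinear_shift_le p a x t : sublinear p -> B a -> B x -> 0 <= t ->
  sublinear_shift p a x <= p (x + t *: a) - t * p a.
Proof.
move=> sp Ba Bx t0; apply: ge_inf; first exact: (shift_has_inf sp Ba Bx).2.
by exists t.
Qed.

Lemma le_sublinear_shift p a x c : sublinear p -> B a -> B x ->
  (forall t, 0 <= t -> c <= p (x + t *: a) - t * p a) ->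
  c <= sublinear_shift p a x.
Proof.
move=> sp Ba Bx h; apply: lb_le_inf; first exact: (shift_has_inf sp Ba Bx).1.
by move=> _ [t /= t0 <-]; exact: h.
Qed.

Lemma sublinear_shiftP p a : sublinear p -> B a ->
  sublinear (sublinear_shift p a).
Proof.
move=> sp Ba.
(* One inequality for all [s > 0] suffices: the reverse one follows by applying it to [t^-1] and
   [t *: x]. *)
have lescale s x : 0 < s -> B x ->
    s * sublinear_shift p a x <= sublinear_shift p a (s *: x).
  move=> s0 Bx; apply: le_sublinear_shift => //; first exact: BZ.
  move=> t t0; have ts0 : 0 <= t / s by rewrite divr_ge0// ltW.
  have := sublinear_shift_le sp Ba Bx ts0.
  rewrite -(ler_pM2l s0) mulrBr -(sp.2 _ _ (ltW s0)); last first.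
    by apply: BD => //; exact: BZ.
  have st : s * (t / s) = t by rewrite mulrC divfK ?gt_eqF.
  by rewrite scalerDr scalerA (mulrA s (t / s)) st.
split=> [x y Bx By|t x].
(* The two infima are bounded one after the other; their parameters [t] and [s] combine to the
   parameter [t + s] for [x + y]. *)
- rewrite -lerBlDr; apply: le_sublinear_shift => // t t0.
  rewrite lerBlDr -lerBlDl; apply: le_sublinear_shift => // s s0.
  have := sublinear_shift_le sp Ba (BD Bx By) (addr_ge0 t0 s0).
  rewrite scalerDl addrACA.
  have := sp.1 _ _ (BD Bx (BZ t Ba)) (BD By (BZ s Ba)); lra.
- rewrite le_eqVlt => /predU1P[<- Bx|t0 Bx].
  + rewrite scale0r mul0r; apply/eqP; rewrite eq_le; apply/andP; split.
      have B0 : B 0 by rewrite -(scale0r x); exact: BZ.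
      have := sublinear_shift_le sp Ba B0 (lexx 0).
      by rewrite scale0r addr0 (sublinear0 sp Bx) mul0r subr0.
    have B0 : B 0 by rewrite -(scale0r x); exact: BZ.
    by apply: le_sublinear_shift => // r r0; rewrite add0r sp.2// subrr.
  + apply/eqP; rewrite eq_le lescale// andbT.
    have ti0 : 0 < t^-1 by rewrite invr_gt0.
    have := lescale _ _ ti0 (BZ t Bx).
    by rewrite scalerA mulVf ?gt_eqF// scale1r -ler_pdivlMl ?invrK// invr_gt0.
Qed.

(* A minimal sublinear functional q is linear: [sublinear_shift q a] is
   sublinear and below q, hence equal to q, which gives q x + q a <= q (x + a).
   Starting from the shift of p by v forces the value at v. *)
Lemma exists_linear_below (p : V -> R) (v : V) : sublinear p -> B v ->
  exists L : V -> R,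
    [/\ forall x y, B x -> B y -> L (x + y) = L x + L y,
        forall t x, B x -> L (t *: x) = t * L x,
        forall x, B x -> L x <= p x &
        p v <= L v].
Proof.
move=> sp Bv.
set p' := sublinear_shift p v.
have sp' : sublinear p' by exact: sublinear_shiftP.
have B0 : B 0 by rewrite -(scale0r v); exact: BZ.
have BN x : B x -> B (- x) by move=> Bx; rewrite -scaleN1r; exact: BZ.
pose Q := {q : V -> R | sublinear q /\ forall x, B x -> q x <= p' x}.
(* The order is reversed, so that the maximal element given by Zorn's lemma is a minimal
   functional. *)
pose ge (q r : Q) := `[< forall x, B x -> sval r x <= sval q x >].
have q0 : Q by exists p'.
have [||A Atot|q qmin] := @ZL_preorder Q q0 ge.
- by move=> q; apply/asboolP.
- move=> r s t /asboolP rs /asboolP st; apply/asboolP => x Bx.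
  exact: le_trans (st x Bx) (rs x Bx).
- have [[q1 Aq1]|nA] := pselect (A !=set0); last first.
    by exists q0 => s As; exfalso; apply: nA; exists s.
  (* The pointwise infimum bounds the chain; the lower bound [- p' (- x)] keeps it finite. *)
  pose m x := inf [set sval q x | q in A].
  have hm x : B x -> has_inf [set sval q x | q in A].
    move=> Bx; split; first by exists (sval q1 x), q1.
    exists (- p' (- x)) => _ [q Aq <-].
    have := sublinear_ge (svalP q).1 Bx.
    by have := (svalP q).2 _ (BN _ Bx); lra.
  have mle x q : B x -> A q -> m x <= sval q x.
    by move=> Bx Aq; apply: ge_inf; [exact: (hm x Bx).2|exists q].
  have le_m x c : B x -> (forall q, A q -> c <= sval q x) -> c <= m x.
    move=> Bx h; apply: lb_le_inf; first exact: (hm x Bx).1.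
    by move=> _ [q Aq <-]; exact: h.
  have sm : sublinear m.
    split=> [x y Bx By|t x t0 Bx].
    + rewrite -lerBlDr; apply: (le_m) => // q Aq.
      rewrite lerBlDr -lerBlDl; apply: (le_m) => // r Ar.
      have Bxy := BD Bx By.
      rewrite lerBlDl.
      (* Of two members of the chain, the smaller one is subadditive and lies below both. *)
      have [/asboolP qr|/asboolP rq] := Atot _ _ Aq Ar.
      * have := (svalP r).1.1 _ _ Bx By; have := mle _ _ Bxy Ar.
        by have := qr _ Bx; lra.
      * have := (svalP q).1.1 _ _ Bx By; have := mle _ _ Bxy Aq.
        by have := rq _ By; lra.
    + move: t0; rewrite le_eqVlt => /predU1P[<-|t0].
        rewrite scale0r mul0r; apply/eqP; rewrite eq_le; apply/andP; split.
          by rewrite -(sublinear0 (svalP q1).1 Bx); exact: mle.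
        by apply: (le_m) => // q Aq; rewrite (sublinear0 (svalP q).1 Bx).
      apply/eqP; rewrite eq_le; apply/andP; split.
        rewrite -ler_pdivrMl//; apply: (le_m) => // q Aq.
        rewrite ler_pdivrMl// -((svalP q).1.2)//; last exact: ltW.
        by apply: mle => //; exact: BZ.
      apply: (le_m) => [|q Aq]; first exact: BZ.
      by rewrite ((svalP q).1.2 _ _ (ltW t0) Bx) ler_pM2l//; exact: mle.
  have mp x : B x -> m x <= p' x.
    by move=> Bx; apply: le_trans (mle _ _ Bx Aq1) _; exact: (svalP q1).2.
  by exists (exist _ m (conj sm mp)) => s As; apply/asboolP => x Bx; exact: mle.
- have [sq qp'] := svalP q.
  have shle a x : B a -> B x -> sublinear_shift (sval q) a x <= sval q x.
    move=> Ba Bx; have := sublinear_shift_le sq Ba Bx (lexx 0).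
    by rewrite scale0r addr0 mul0r subr0.
  have qD x a : B x -> B a -> sval q (x + a) = sval q x + sval q a.
    move=> Bx Ba; apply/eqP; rewrite eq_le sq.1//=.
    have ss := sublinear_shiftP sq Ba.
    have sle y : B y -> sublinear_shift (sval q) a y <= p' y.
      by move=> By; apply: le_trans (shle _ _ Ba By) (qp' _ By).
    have /asboolP/(_ x Bx)/= h :
        ge (exist _ (sublinear_shift (sval q) a) (conj ss sle)) q.
      by apply: qmin; apply/asboolP => y By /=; exact: shle.
    have := sublinear_shift_le sq Ba Bx ler01; rewrite scale1r mul1r; lra.
  have qN x : B x -> sval q (- x) = - sval q x.
    move=> Bx; apply/eqP; rewrite -addr_eq0 -qD//; last exact: BN.
    by rewrite addNr (sublinear0 sq Bx).
  have p'p x : B x -> p' x <= p x.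
    move=> Bx; have := sublinear_shift_le sp Bv Bx (lexx 0).
    by rewrite scale0r addr0 mul0r subr0.
  exists (sval q); split => // [t x Bx|x Bx|].
  + have [t0|t0] := leP 0 t; first exact: sq.2.
    have := sq.2 (- t) (- x); rewrite scalerN scaleNr opprK => -> //.
    * by rewrite qN// mulrNN.
    * by rewrite oppr_ge0 ltW.
    * exact: BN.
  + exact: le_trans (qp' _ Bx) (p'p _ Bx).
  (* At [t = 1] the shift at [- v] is at most [p 0 - p v = - p v]. *)
  + have := qp' _ (BN _ Bv); rewrite qN//.
    have := sublinear_shift_le sp Bv (BN _ Bv) ler01.
    rewrite scale1r addNr (sublinear0 sp Bv) mul1r -/p'; lra.
Qed.

End sublinear.

(** * Regularity of Borel probabilities *)

Section metric_topology.
Context {R : realType} {T : pmetricType R}.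
Implicit Types (A B O : set T) (x y : T).

Lemma nbhs_mdistP x A :
  nbhs x A <-> exists2 e : R, 0 < e & [set y | mdist x y < e] `<=` A.
Proof.
split=> [/nbhs_ballP[e /= e0]|[e e0 eA]].
  by rewrite ballEmdist => eA; exists e.
by apply/nbhs_ballP; exists e => //=; rewrite ballEmdist.
Qed.

Lemma lipschitz1_continuous (g : T -> R) : lipschitz1 g -> continuous g.
Proof.
move=> g1 x; apply/cvgrPdist_lt => e e0.
apply/nbhs_mdistP; exists e => // y /= xy.
exact: le_lt_trans (g1 x y) xy.
Qed.

Lemma ler_dist_mdist x y x' y' :
  `|mdist x y - mdist x' y'| <= mdist x x' + mdist y y'.
Proof.
have a := metric_triangle x x' y; have b := metric_triangle x' y' y.
have c := metric_triangle x' x y'; have d := metric_triangle x y y'.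
rewrite (metric_sym x' x) in c; rewrite (metric_sym y' y) in b.
by rewrite ler_norml; lra.
Qed.

Lemma mdist_lipschitz1 x : lipschitz1 (mdist x).
Proof.
move=> y z; apply: le_trans (ler_dist_mdist _ _ _ _) _.
by rewrite mdistxx add0r.
Qed.

Lemma mdist_continuous : continuous (fun z : T * T => mdist z.1 z.2).
Proof.
move=> [x y]; apply/cvgrPdist_lt => /= e e0.
have e20 : 0 < e / 2 by rewrite divr_gt0.
exists ([set x' | mdist x x' < e / 2], [set y' | mdist y y' < e / 2]) => /=.
  by split; apply/nbhs_mdistP; exists (e / 2).
move=> [x' y'] /= [xx' yy']; apply: le_lt_trans (ler_dist_mdist _ _ _ _) _.
by rewrite (splitr e) ltrD.
Qed.

Lemma closed_mdist_le x r : closed [set y | mdist x y <= r].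
Proof.
have /continuousP/= := lipschitz1_continuous (mdist_lipschitz1 x).
move=> /(_ [set t | r < t] (@open_gt _ r)) o.
rewrite (_ : [set y | _] = ~` (mdist x @^-1` [set t | r < t])).
  exact: open_closedC.
by apply/seteqP; split=> y /=; rewrite leNgt => /negP.
Qed.

Lemma open_mdist_lt x r : open [set y | mdist x y < r].
Proof.
have /continuousP/= := lipschitz1_continuous (mdist_lipschitz1 x).
by move=> /(_ [set t | t < r] (@open_lt _ r)).
Qed.

Lemma closed_borel (A : set T) : closed A -> measurable (A : set (borelType T)).
Proof.
move=> cA; rewrite -[A]setCK; apply: measurableC.
by apply: sub_sigma_algebra; exact: closed_openC.
Qed.

Lemma open_borel (A : set T) : open A -> measurable (A : set (borelType T)).
Proof. exact: sub_sigma_algebra. Qed.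

Lemma compact_closed_metric (A : set T) : compact A -> closed A.
Proof. by apply: compact_closed; exact: metric_hausdorff. Qed.

Lemma compact_borel (A : set T) : compact A ->
  measurable (A : set (borelType T)).
Proof. by move=> /compact_closed_metric/closed_borel. Qed.

Lemma separable_seq : separable T ->
  exists a : nat -> T, forall x (e : R), 0 < e -> exists n, mdist (a n) x < e.
Proof.
move=> [D /countable_injP[f finj] dD].
(* The enumeration inverts the injection [f] on [D]; a number that [f] does not take on [D] is sent
   to the default point, which does no harm. *)
exists (fun n => get [set x | D x /\ f x = n]) => x e e0.
have [] := dD [set y | mdist x y < e]°.
- exists x; apply/nbhs_mdistP; by exists e.
- exact: open_interior.
- move=> y [/interior_subset/= xy Dy].
  exists (f y); rewrite (_ : get _ = y); first by rewrite metric_sym.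
  have [/= Dg fg] : [set x | D x /\ f x = f y] (get [set x | D x /\ f x = f y]).
    exact: (@getI _ _ y).
  by apply: finj; rewrite ?inE.
Qed.

(** Balls of radius [1 / (m + 1)] around a dense sequence form a countable base. The open ball
    contains the point and the closed one lies inside [A], so both kinds of balls can be used. *)
Lemma nbhs_dense_ball (a : nat -> T) x A :
  (forall x (e : R), 0 < e -> exists n, mdist (a n) x < e) -> nbhs x A ->
  exists2 i : nat * nat, mdist (a i.1) x < i.2.+1%:R^-1 &
    [set y | mdist (a i.1) y <= i.2.+1%:R^-1] `<=` A.
Proof.
move=> ad /nbhs_mdistP[e e0 eA].
have e20 : 0 < e / 2 by rewrite divr_gt0.
have [m _ /(_ m (leqnn _)) me] := near_infty_natSinv_lt (PosNum e20).
have m0 : (0 : R) < m.+1%:R^-1 by rewrite invr_gt0.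
have [n nx] := ad x _ m0.
exists (n, m) => // y /= yb; apply: eA => /=.
apply: le_lt_trans (metric_triangle _ (a n) _) _.
rewrite metric_sym (splitr e); apply: ltrD; first exact: lt_trans nx me.
exact: le_lt_trans yb me.
Qed.

(** * Sigma-compactness of open and closed sets *)

Definition sigma_compact A :=
  exists2 K : nat -> set T, (forall n, compact (K n)) & A = \bigcup_n K n.

Lemma sigma_compact_countable (I : countType) (K : I -> set T) :
  (forall i, compact (K i)) -> sigma_compact (\bigcup_i K i).
Proof.
move=> cK; exists (fun n => oapp K set0 (unpickle n)).
  by move=> n; case: unpickle => //=; exact: compact0.
apply/seteqP; split=> [x [i _ Kix]|x [n _]].
  by exists (pickle i) => //; rewrite pickleK.
by case: unpickle => //= i Kix; exists i.
Qed.

Hypothesis T_lcompact : locally_compact [set: T].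
Hypothesis T_separable : separable T.

(** Among the countably many closed balls of [nbhs_dense_ball], those that are compact and lie in
    [O] already cover [O]: around each point a small closed ball sits inside a compact
    neighbourhood. *)
Lemma open_sigma_compact O : open O -> sigma_compact O.
Proof.
move=> oO; have [a ad] := separable_seq T_separable.
pose b (i : nat * nat) := [set y | mdist (a i.1) y <= i.2.+1%:R^-1].
pose K i := if `[< compact (b i) /\ b i `<=` O >] then b i else set0.
suff -> : O = \bigcup_i K i.
  apply: sigma_compact_countable => i; rewrite /K.
  by case: asboolP => [[]//|_]; exact: compact0.
apply/seteqP; split=> [x Ox|x [i _]]; last first.
  by rewrite /K; case: asboolP => [[_]|//]; exact.
have [U xU [cU clU]] := @T_lcompact x I.
have Ux : nbhs x U by move: xU; rewrite /within/=; apply: filterS => y; exact.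
have [|i bx bOU] := @nbhs_dense_ball a x (O `&` U) ad.
  by apply: filterI => //; exact: open_nbhs_nbhs.
exists i => //; rewrite /K; case: asboolP => [_|[]]; first exact: ltW.
split; last by move=> y /bOU[].
apply: (subclosed_compact _ cU); last by move=> y /bOU[].
exact: closed_mdist_le.
Qed.

Lemma closed_sigma_compact A : closed A -> sigma_compact A.
Proof.
move=> cA; have [K cK KT] := open_sigma_compact openT.
exists (fun n => K n `&` A); first by move=> n; exact: compact_closedI.
by rewrite -setI_bigcupl -KT setTI.
Qed.

(** * Inner and outer regularity *)

Section inner_regular.
Variable mu : probability (borelType T) R.

Definition inner_regular A := forall e : R, 0 < e ->
  exists K, [/\ compact K, K `<=` A & (mu (A `\` K) <= e%:E)%E].

(** The finite unions of the compact pieces exhaust [A], so the measure of the remainders tends to 0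
    by continuity from above. *)
Lemma sigma_compact_inner_regular A : sigma_compact A -> inner_regular A.
Proof.
move=> [K cK ->] e e0.
pose F n : set (borelType T) := \bigcup_n K n `\` \bigcup_(i < n) K i.
have mK n : measurable (K n : set (borelType T)) by exact: compact_borel.
have mU : measurable (\bigcup_n K n : set (borelType T)).
  by apply: bigcup_measurable => n _.
have mF n : measurable (F n).
  by apply: measurableD => //; apply: bigcup_measurable => i _.
have F0 : \bigcap_n F n = set0.
  apply/seteqP; split=> // x Fx.
  have [[n _ Knx] _] := Fx 0%N I.
  by have [_] := Fx n.+1 I; apply; exists n => /=.
have niF : nonincreasing_seq F.
  move=> m n mn; apply/subsetPset; apply: setDS.
  by apply: bigcup_sub => i /= im; apply: bigcup_sup => /=; exact: leq_trans mn.
have : mu \o F @ \oo --> mu (\bigcap_n F n).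
  apply: nonincreasing_cvg_mu => //; last by rewrite F0.
  by rewrite (le_lt_trans (probability_le1 _ _))// ltry.
rewrite F0 measure0 => /fine_cvgP[_ /cvgrPdist_lt/(_ e e0)[n _]].
move=> /(_ n (leqnn _)).
rewrite /= sub0r normrN => ne.
exists (\bigcup_(i < n) K i); split.
- rewrite bigcup_mkord; exact: bigsetU_compact.
- by apply: bigcup_sub => i _; exact: bigcup_sup.
- have Fn : (fine (mu (F n)))%:E = mu (F n) by rewrite fineK// fin_num_measure.
  rewrite -/(F n) -[X in (X <= _)%E]Fn lee_fin.
  by apply: le_trans (ler_norm _) (ltW ne).
Qed.

Let sumD_le (A K : nat -> set (borelType T)) (e : R) (B : set (borelType T)) :
  0 <= e -> measurable B ->
  (forall n, measurable (A n)) -> (forall n, measurable (K n)) ->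
  B `<=` \bigcup_n (A n `\` K n) ->
  (forall n, (mu (A n `\` K n) <= (e / (2 ^ n.+1)%:R)%:E)%E) ->
  (mu B <= e%:E)%E.
Proof.
move=> e0 mB mA mK BAK le.
apply: le_trans (epsilon_trick0 xpredT e0).
apply: le_trans (lee_nneseries _ (fun n _ => le n)) => //.
apply: measure_sigma_subadditive => // n; exact: measurableD.
Qed.

(** The union of the compact subsets of the [A n] is only sigma-compact, so one half of [e] pays for
    the passage to it and the other half for a compact subset of it. *)
Lemma inner_regular_bigcup (A : nat -> set T) :
  (forall n, measurable (A n : set (borelType T))) ->
  (forall n, inner_regular (A n)) -> inner_regular (\bigcup_n A n).
Proof.
move=> mA iA e e0.
have e2 n : 0 < e / 2 / (2 ^ n.+1)%:R.
  by rewrite !divr_gt0// ltr0n expn_gt0.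
have /choice[K /all_and3[cK KA Ke]] n := iA n _ (e2 n).
have e20 : 0 < e / 2 by rewrite divr_gt0.
have [|L [cL LK Le]] := @sigma_compact_inner_regular (\bigcup_n K n) _ _ e20.
  by exists K.
have mK n : measurable (K n : set (borelType T)) by exact: compact_borel.
have mL : measurable (L : set (borelType T)) by exact: compact_borel.
have mUK : measurable (\bigcup_n K n : set (borelType T)).
  by apply: bigcup_measurable => n _.
have mUA : measurable (\bigcup_n A n : set (borelType T)).
  by apply: bigcup_measurable => n _.
exists L; split => //.
  by apply: subset_trans LK _ => x [n _ /KA Anx]; exists n.
rewrite (splitr e) EFinD.
apply: (@le_trans _ _ (mu (\bigcup_n A n `\` \bigcup_n K n)
                       + mu (\bigcup_n K n `\` L))%E).
  apply: le_trans (measureU2 _ _ _); [|exact: measurableD..].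
  apply: le_measure; rewrite ?inE; [|apply: measurableU|];
    try exact: measurableD.
  move=> x [Ax nLx].
  by have [Kx|nKx] := pselect ((\bigcup_n K n) x); [right|left].
apply: leeD => //; apply: (@sumD_le A K) => //.
- exact: ltW.
- exact: measurableD.
- move=> x [[n _ Anx] nK]; exists n => //; split => // Knx.
  by apply: nK; exists n.
Qed.

(** Here the intersection of the compact subsets is itself compact, and the errors [e / 2 ^ n.+1]
    sum to [e]. *)
Lemma inner_regular_bigcap (A : nat -> set T) :
  (forall n, measurable (A n : set (borelType T))) ->
  (forall n, inner_regular (A n)) -> inner_regular (\bigcap_n A n).
Proof.
move=> mA iA e e0.
have e2 n : 0 < e / (2 ^ n.+1)%:R.
  by rewrite !divr_gt0// ltr0n expn_gt0.
have /choice[K /all_and3[cK KA Ke]] n := iA n _ (e2 n).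
have mK n : measurable (K n : set (borelType T)) by exact: compact_borel.
exists (\bigcap_n K n); split.
- apply: (subclosed_compact _ (cK 0%N)); last by move=> x; exact.
  by apply: closed_bigI => n _; exact: compact_closed_metric.
- by move=> x Kx n _; apply: KA; exact: Kx.
- apply: (@sumD_le A K) => //; first exact: ltW.
    by apply: measurableD; apply: bigcap_measurableType => n _.
  move=> x [Ax /existsNP[n /not_implyP[_ nKx]]].
  by exists n => //; split => //; exact: Ax.
Qed.

(** Sets that are inner regular together with their complement form a sigma-algebra, which contains
    the open sets because open and closed sets are sigma-compact. The complement is carried along,
    since inner regularity alone is not visibly stable under complements. *)
Lemma borel_inner_regular (A : set (borelType T)) :
  measurable A -> inner_regular A.
Proof.
move=> mA; pose G (B : set (borelType T)) :=
  [/\ measurable B, inner_regular B & inner_regular (~` B)].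
suff /(_ A mA)[] : measurable `<=` G by [].
apply: smallest_sub; last first.
  move=> O oO; split; first exact: open_borel.
    exact/sigma_compact_inner_regular/open_sigma_compact.
  exact/sigma_compact_inner_regular/closed_sigma_compact/open_closedC.
split.
- split => //; first exact/sigma_compact_inner_regular/open_sigma_compact/open0.
  rewrite setC0; exact/sigma_compact_inner_regular/open_sigma_compact/openT.
- move=> B [mB iB iCB]; rewrite setTD; split; rewrite ?setCK//.
  exact: measurableC.
- move=> F GF.
  have mF n : measurable (F n : set (borelType T)) by have [] := GF n.
  split; first by apply: bigcup_measurable => n _.
    by apply: inner_regular_bigcup => // n; have [] := GF n.
  rewrite setC_bigcup; apply: inner_regular_bigcap => n.
    exact: measurableC.
  by have [] := GF n.
Qed.

(** Dual to inner regularity: [U] is the complement of a compact subset of the complement of [A]. *)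
Lemma borel_outer_regular (A : set (borelType T)) (e : R) :
  measurable A -> 0 < e -> exists U : set T,
    [/\ open U, A `<=` U & (mu (U `\` A) <= e%:E)%E].
Proof.
move=> mA e0.
have [K [cK KA Ke]] := borel_inner_regular (measurableC mA) e0.
exists (~` K); split.
- by apply: closed_openC; exact: compact_closed_metric cK.
- by rewrite -[A]setCK; exact: subsetC.
- by rewrite setDE setIC -setDE.
Qed.

End inner_regular.

End metric_topology.

(** * From positive functionals to couplings *)

Definition rect_display : measure_display -> measure_display -> measure_display.
Proof. by move=> d _; exact: d. Qed.

Section rectangles.
Context d1 d2 (X : measurableType d1) (Y : measurableType d2).

(** An alias of the product, so that it carries the semiring of rectangles instead of the product
    sigma-algebra. *)
Definition rect_type : Type := (X * Y)%type.

Definition rect : set (set rect_type) :=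
  [set A `*` B | A in measurable & B in measurable].

Lemma rectX (A : set X) (B : set Y) :
  measurable A -> measurable B -> rect (A `*` B).
Proof. by move=> mA mB; exists A => //; exists B. Qed.

Lemma rect0 : rect set0.
Proof. by exists set0 => //; exists set0 => //; exact: setX0. Qed.

Lemma rectI : setI_closed rect.
Proof.
move=> _ _ [A mA [B mB <-]] [A' mA' [B' mB' <-]]; rewrite -setXI.
by apply: rectX; exact: measurableI.
Qed.

Lemma rectD : semi_setD_closed rect.
Proof.
move=> _ _ [A mA [B mB <-]] [A' mA' [B' mB' <-]].
(* The difference splits according to whether the second coordinate lies in [B'], which makes the
   two rectangles disjoint. *)
exists [set A `*` (B `\` B'); (A `\` A') `*` (B `&` B')]; split.
- exact: finite_set2.
- move=> _ [->|->]; apply: rectX => //; try exact: measurableD.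
  exact: measurableI.
- rewrite bigcup_setU !bigcup_set1; apply/seteqP; split=> [[x y] /=|[x y] /=].
    move=> [[Ax By] nAB]; have [B'y|nB'y] := pselect (B' y); last by left.
    by right; split => //; split => // A'x; exact: nAB.
  by move=> [[Ax [By nBy]]|[[Ax nAx] [By By']]]; split=> //= -[].
- have dj x y : ~ ((A `*` (B `\` B')) (x, y) /\
                    ((A `\` A') `*` (B `&` B')) (x, y)).
    by move=> -[[_ [_ nB'y]] [_ [_ B'y]]].
  by move=> _ _ [->|->] [->|->] // [[x y] [h1 h2]]; case: (dj x y).
Qed.

HB.instance Definition _ := Pointed.on rect_type.
HB.instance Definition _ :=
  @isSemiRingOfSets.Build (rect_display d1 d2) rect_type rect rect0 rectI rectD.

End rectangles.

(** * Positive functionals on bounded functions *)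

Section functional.
Context {R : realType} {X : Type}.
Implicit Types (f g h : X -> R).

(** Boundedness is a predicate on the module of all functions, to be used as the subspace [B] of
    [exists_linear_below]. *)
Definition bounded_fct f := exists M, forall z, `|f z| <= M.

Lemma bounded_fctD f g :
  bounded_fct f -> bounded_fct g -> bounded_fct (f + g).
Proof.
move=> [M fM] [N gN]; exists (M + N) => z.
by apply: le_trans (ler_normD _ _) _; exact: lerD.
Qed.

Lemma add_fctE f g z : (f + g) z = f z + g z.
Proof. by []. Qed.

Lemma scale_fctE t f z : (t *: f) z = t * f z.
Proof. by []. Qed.

Lemma bounded_fctZ t f : bounded_fct f -> bounded_fct (t *: f).
Proof.
move=> [M fM]; exists (`|t| * M) => z.
by rewrite scale_fctE normrM ler_wpM2l.
Qed.

Lemma bounded_fct_indic A : bounded_fct (\1_A : X -> R).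
Proof.
by exists 1 => z; rewrite indicE; case: (_ \in _); rewrite ?normr1 ?normr0.
Qed.

Lemma bounded_fct_cst c : bounded_fct (fun=> c).
Proof. by exists `|c|. Qed.

Definition positive_functional (L : (X -> R) -> R) :=
  [/\ forall f g, bounded_fct f -> bounded_fct g -> L (f + g) = L f + L g,
      forall t f, bounded_fct f -> L (t *: f) = t * L f &
      forall f, bounded_fct f -> (forall z, 0 <= f z) -> 0 <= L f].

Section theory.
Variable L : (X -> R) -> R.
Hypothesis LP : positive_functional L.

Lemma functionalD f g : bounded_fct f -> bounded_fct g -> L (f + g) = L f + L g.
Proof. by have [+ _ _] := LP; exact. Qed.

Lemma functionalZ t f : bounded_fct f -> L (t *: f) = t * L f.
Proof. by have [_ + _] := LP; exact. Qed.

Lemma functional_ge0 f : bounded_fct f -> (forall z, 0 <= f z) -> 0 <= L f.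
Proof. by have [_ _] := LP; exact. Qed.

Lemma functional0 : L 0 = 0.
Proof.
by rewrite -(scale0r (0 : X -> R)) functionalZ ?mul0r//; exact: bounded_fct_cst.
Qed.

Lemma functional_le f g : bounded_fct f -> bounded_fct g ->
  (forall z, f z <= g z) -> L f <= L g.
Proof.
move=> bf bg fg; have bN : bounded_fct (- f).
  by rewrite -scaleN1r; exact: bounded_fctZ.
rewrite -subr_ge0 -mulN1r -functionalZ// scaleN1r -functionalD//.
by apply: functional_ge0 => [|z]; [exact: bounded_fctD|rewrite subr_ge0].
Qed.

Lemma functional_sum (I : Type) (s : seq I) (F : I -> X -> R) :
  (forall i, bounded_fct (F i)) ->
  bounded_fct (\sum_(i <- s) F i) /\
  L (\sum_(i <- s) F i) = \sum_(i <- s) L (F i).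
Proof.
move=> bF; elim: s => [|i s [bs IH]].
  by rewrite !big_nil functional0; split => //; exact: bounded_fct_cst.
rewrite !big_cons functionalD// IH; split => //; exact: bounded_fctD.
Qed.

End theory.
End functional.

Section functional_content.
Context {R : realType} d (X : semiRingOfSetsType d) (L : (X -> R) -> R).
Hypothesis LP : positive_functional L.

Lemma functional_indic_additive (F : nat -> set X) n : trivIset setT F ->
  L (\1_(\big[setU/set0]_(i < n) F i)) = \sum_(i < n) L (\1_(F i)).
Proof.
move=> tF; rewrite -(functional_sum LP _ (fun i => bounded_fct_indic _)).2.
congr L; apply/funext => z.
elim: n => [|n IH]; first by rewrite !big_ord0 indic0.
rewrite !big_ord_recr /= -[RHS]/((_ : R) + _) /= -IH !indicE.
have [Fz|nFz] := boolP (z \in F n); last first.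
  rewrite addr0; congr (_%:R); rewrite in_setU (negbTE nFz) orbF//.
rewrite in_setU Fz orbT (_ : z \in _ = false) ?add0r//.
apply/negbTE; rewrite notin_setE -bigcup_mkord => -[i /= ilt Fiz].
move: Fz; rewrite inE => Fz.
have /trivIsetP/(_ i n I I)/(_ _)/seteqP[|+ _] := tF.
  by rewrite (ltn_eqF ilt).
by move=> /(_ z); apply.
Qed.

End functional_content.

(** * Extension of a positive functional to a measure *)

Section rectangle_measure.
Context {R : realType} {T : pmetricType R}.
Hypothesis T_lcompact : locally_compact [set: T].
Hypothesis T_separable : separable T.
Variables mu nu : probability (borelType T) R.
Variable L : (T * T -> R) -> R.
Hypothesis LP : positive_functional L.
Hypothesis Lmu : forall A : set (borelType T), measurable A ->
  L (fun z => \1_A z.1) = fine (mu A).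
Hypothesis Lnu : forall A : set (borelType T), measurable A ->
  L (fun z => \1_A z.2) = fine (nu A).

Local Notation bT := (borelType T).
Local Notation rT := (rect_type bT bT).

Let bounded1 (A : set bT) : bounded_fct (fun z : T * T => \1_A z.1 : R).
Proof. by have [M h] := @bounded_fct_indic R T A; exists M => z; exact: h. Qed.

Let bounded2 (A : set bT) : bounded_fct (fun z : T * T => \1_A z.2 : R).
Proof. by have [M h] := @bounded_fct_indic R T A; exists M => z; exact: h. Qed.

(** A point of [A x B] outside [C x D] has its first coordinate in [A \ C] or its second in [B \ D].
    The bound serves both to shrink a rectangle to a compact one and to enlarge it to an open
    one. *)
Lemma functional_rect_le (A B C D : set bT) :
  measurable A -> measurable B -> measurable C -> measurable D ->
  L (\1_(A `*` B)) <=
  L (\1_(C `*` D)) + fine (mu (A `\` C)) + fine (nu (B `\` D)).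
Proof.
move=> mA mB mC mD.
rewrite -(Lmu (measurableD mA mC)) -(Lnu (measurableD mB mD)).
have bI Z : bounded_fct (\1_Z : T * T -> R) by exact: bounded_fct_indic.
have bs := bounded_fctD (bI (C `*` D)) (bounded1 (A `\` C)).
rewrite -(functionalD LP)// -(functionalD LP)//.
apply: functional_le => //; first exact: bounded_fctD.
move=> [x y]; rewrite !fctE/= !indicE !in_setD !in_setX/=.
by do 4 case: (_ \in _); rewrite /= ?mulr0n ?mulr1n; lra.
Qed.

Definition rect_content (A : set rT) : \bar R := (L \1_A)%:E.

Let rect_content_ge0 A : (0 <= rect_content A)%E.
Proof.
rewrite lee_fin; apply: (functional_ge0 LP); first exact: bounded_fct_indic.
by move=> z; rewrite indicE.
Qed.

Let rect_content_additive : measure_function.semi_additive rect_content.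
Proof.
move=> F n _ tF _; rewrite /rect_content sumEFin; congr EFin.
exact: (@functional_indic_additive _ _ rT _ LP).
Qed.

HB.instance Definition _ := isContent.Build _ rT R rect_content
  rect_content_ge0 rect_content_additive.

Let fine_le (m : probability bT R) (A : set bT) (e : R) :
  measurable A -> (m A <= e%:E)%E -> fine (m A) <= e.
Proof. by move=> mA; rewrite -lee_fin fineK// fin_num_measure. Qed.

(* Compactness upgrades finite additivity: shrink A x B to a compact
   rectangle and enlarge the covering rectangles to open ones, then finitely
   many of them already cover. *)
Lemma rect_content_sigma_subadditive :
  measurable_subset_sigma_subadditive rect_content.
Proof.
move=> AB F mF [A mA [B mB <-]] ABF.
have /choice[P] : forall n, exists P : set bT * set bT,
    [/\ measurable P.1, measurable P.2 & P.1 `*` P.2 = F n].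
  by move=> n; have [P mP [Q mQ PQ]] := mF n; exists (P, Q).
move=> /all_and3[mP mQ PQ].
apply/lee_addgt0Pr => e e0.
(* The error is split in halves: [e / 2] for shrinking [A x B], with [e / 4] per factor, and [e / 2]
   for all the enlargements together. *)
have e40 : 0 < e / 4 by rewrite divr_gt0.
have e2 n : 0 < e / 4 / (2 ^ n.+1)%:R.
  by rewrite !divr_gt0// ltr0n expn_gt0.
have [K [cK KA Ke]] := borel_inner_regular T_lcompact T_separable mu mA e40.
have [H [cH HB He]] := borel_inner_regular T_lcompact T_separable nu mB e40.
have /choice[U /all_and3[oU PU Ue]] n :=
  borel_outer_regular T_lcompact T_separable mu (mP n) (e2 n).
have /choice[V /all_and3[oV QV Ve]] n :=
  borel_outer_regular T_lcompact T_separable nu (mQ n) (e2 n).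
have mK : measurable (K : set bT) by exact: compact_borel.
have mH : measurable (H : set bT) by exact: compact_borel.
have mU n : measurable (U n : set bT) by exact: open_borel.
have mV n : measurable (V n : set bT) by exact: open_borel.
have [N KHD] : exists N, forall z, (K `*` H) z ->
    exists2 i, (i < N)%N & (U i `*` V i) z.
  (* Compactness in filter form: near each point, covering by the first [N] open rectangles holds
     for all large [N], hence on all of [K x H] for one [N]. *)
  have /compact_near_coveringP := compact_setX cK cH.
  move=> /(_ nat \oo (fun N z => exists2 i, (i < N)%N & (U i `*` V i) z) _).
  move=> [|N _ h].
    move=> [x y] [/= Kx Hy]; have [|n _] := ABF (x, y).
      by split; [exact: KA|exact: HB].
    rewrite -PQ => -[/= Px Qy].
    exists (U n `*` V n, [set m | (n < m)%N]) => /=.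
      split; last by exists n.+1.
      exists (U n, V n) => //=.
      by split; apply: open_nbhs_nbhs; split => //; [exact: PU|exact: QV].
    by move=> [z m] /= [zUV nm]; exists n.
  by exists N => z; exact: (h N (leqnn _)).
have bI Z : bounded_fct (\1_Z : T * T -> R) by exact: bounded_fct_indic.
have KHN : L (\1_(K `*` H)) <= \sum_(i < N) L (\1_(U i `*` V i)).
  have [bs <-] :=
    functional_sum LP (index_enum 'I_N) (fun i => bI (U i `*` V i)).
  apply: functional_le => //.
  move=> z; rewrite fct_sumE indicE.
  case: (boolP (z \in _)) => [|_]; last first.
    by apply: sumr_ge0 => i _; rewrite indicE.
  rewrite inE => /KHD[n /= nN UVz]; rewrite (bigD1 (Ordinal nN))//=.
  rewrite indicE mem_set// lerDl; apply: sumr_ge0 => i _.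
  by rewrite indicE.
have UVle i : L (\1_(U i `*` V i)) <= L \1_(F i) + e / 2 / (2 ^ i.+1)%:R.
  apply: le_trans (functional_rect_le (mU i) (mV i) (mP i) (mQ i)) _.
  rewrite PQ -addrA lerD2l (splitr (e / 2)) -mulrA -invfM -natrM /= mulrDl.
  by apply: lerD; apply: fine_le => //; exact: measurableD.
have ABKH : L (\1_(A `*` B)) <= L (\1_(K `*` H)) + e / 2.
  apply: le_trans (functional_rect_le mA mB mK mH) _.
  rewrite -addrA lerD2l (splitr (e / 2)) -mulrA -invfM -natrM /=.
  by apply: lerD; apply: fine_le => //; exact: measurableD.
rewrite (splitr e) EFinD addeA.
apply: (@le_trans _ _ (\sum_(0 <= i <oo) (rect_content (F i) +
    (e / 2 / (2 ^ i.+1)%:R)%:E) + (e / 2)%:E)%E).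
  apply: (@le_trans _ _ ((\sum_(i < N) L (\1_(U i `*` V i)))%:E +
      (e / 2)%:E)%E).
    rewrite -EFinD lee_fin; apply: le_trans ABKH _.
    by rewrite lerD2r.
  rewrite leeD2r//; apply: le_trans (nneseries_lim_ge N _); last first.
    move=> n _ _; apply: adde_ge0 => //.
    by rewrite lee_fin divr_ge0// ltW// divr_gt0.
  rewrite big_mkord -sumEFin; apply: lee_sum => i _.
  by rewrite /rect_content -EFinD lee_fin.
rewrite leeD2r//; apply: epsilon_trick => //.
by rewrite divr_ge0// ltW.
Qed.

HB.instance Definition _ := Content_SigmaSubAdditive_isMeasure.Build _ R rT
  rect_content rect_content_sigma_subadditive.

(** Separability enters here: every open set of the product is a countable union of products of
    balls, so the rectangles generate all Borel sets. *)
Let open_sub_rect : <<s @open (T * T)%type >> `<=`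
  (@measurable _ rT).-sigma.-measurable.
Proof.
apply: smallest_sub; first exact: sigma_algebra_measurable.
move=> O oO; have [a ad] := separable_seq T_separable.
pose b (i : nat * nat) := [set y | mdist (a i.1) y < i.2.+1%:R^-1 :> R].
pose F (k : (nat * nat) * (nat * nat)) : set (T * T) :=
  if `[< b k.1 `*` b k.2 `<=` O >] then b k.1 `*` b k.2 else set0.
have -> : O = \bigcup_k F k.
  apply/seteqP; split=> [[x y] Oxy|z [k _]]; last first.
    by rewrite /F; case: asboolP => // + Fz; exact.
  have [[P Q] /= [xP yQ] PQO] : nbhs (x, y) O by exact: open_nbhs_nbhs.
  have [i bi iP] := nbhs_dense_ball ad xP.
  have [j bj jQ] := nbhs_dense_ball ad yQ.
  exists (i, j) => //; rewrite /F; case: asboolP => [_|[]] //=.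
  move=> [x' y'] [/= bx' by']; apply: PQO; split => /=.
    by apply: iP; exact: ltW.
  by apply: jQ; exact: ltW.
apply: countable_bigcupT_measurable => // k.
rewrite /F; case: asboolP => // _; apply: sub_sigma_algebra.
by apply: rectX; apply: open_borel; exact: open_mdist_lt.
Qed.

(** The Caratheodory extension lives on the sigma-algebra generated by the rectangles; by
    [open_sub_rect] it may be read on the Borel sets of the product. *)
Definition functional_measure : set (borelType (T * T)%type) -> \bar R :=
  measure_extension rect_content.

Lemma functional_measureX (A B : set bT) : measurable A -> measurable B ->
  functional_measure (A `*` B) = (L \1_(A `*` B))%:E.
Proof.
by move=> mA mB; apply: measurable_mu_extE; exact: rectX.
Qed.

Let functional_measure0 : functional_measure set0 = 0%E.
Proof. exact: measure0. Qed.

Let functional_measure_ge0 A : (0 <= functional_measure A)%E.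
Proof. exact: measure_ge0. Qed.

Let functional_measure_sigma_additive : semi_sigma_additive functional_measure.
Proof.
move=> F mF tF mUF.
apply: (@measure_semi_sigma_additive _ _ _ (measure_extension rect_content)) =>
  //.
  by move=> i; exact: (open_sub_rect (mF i)).
exact: (open_sub_rect mUF).
Qed.

HB.instance Definition _ := isMeasure.Build _ _ _ functional_measure
  functional_measure0 functional_measure_ge0 functional_measure_sigma_additive.

Lemma functional_measure1 (A : set bT) : measurable A ->
  functional_measure (fst @^-1` A) = mu A.
Proof.
move=> mA; rewrite (_ : _ @^-1` A = A `*` setT); last first.
  by apply/seteqP; split => z //= -[].
rewrite functional_measureX//; transitivity (fine (mu A))%:E.
  rewrite -Lmu//; congr (L _)%:E; apply/funext => z.
  by rewrite !indicE in_setX in_setT andbT.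
by rewrite fineK// fin_num_measure.
Qed.

Lemma functional_measure2 (A : set bT) : measurable A ->
  functional_measure (snd @^-1` A) = nu A.
Proof.
move=> mA; rewrite (_ : _ @^-1` A = setT `*` A); last first.
  by apply/seteqP; split => z //= -[].
rewrite functional_measureX//; transitivity (fine (nu A))%:E.
  rewrite -Lnu//; congr (L _)%:E; apply/funext => z.
  by rewrite !indicE in_setX in_setT.
by rewrite fineK// fin_num_measure.
Qed.

Let functional_measureT : functional_measure setT = 1%E.
Proof.
by rewrite -(preimage_setT fst) functional_measure1// probability_setT.
Qed.

HB.instance Definition _ := Measure_isProbability.Build _ _ _ functional_measure
  functional_measureT.

End rectangle_measure.

(** * Borel measurability, quantization and the cost bound *)

Lemma measurable_fun_g_sigma {R : realType} (X : pointedType)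
    (G : set (set X)) (f : g_sigma_algebraType G -> R) :
  (forall r, G (f @^-1` [set t | r < t])) -> measurable_fun setT f.
Proof.
move=> Gf; apply: (measurability _ (RGenOInfty.measurableE R)) => //.
move=> _ [_ [r ->] <-]; rewrite setTI; apply: sub_sigma_algebra.
by rewrite (_ : f @^-1` _ = f @^-1` [set t | r < t])//; apply/seteqP;
  split => z /=; rewrite in_itv/= andbT.
Qed.

Section quantization.
Context {R : realType} {T : pmetricType R}.
Hypothesis T_lcompact : locally_compact [set: T].
Hypothesis T_separable : separable T.

Local Notation bT := (borelType T).

Lemma continuous_borel_measurable (f : T -> R) :
  continuous f -> measurable_fun setT (f : bT -> R).
Proof.
move=> /continuousP cf; apply: measurable_fun_g_sigma => r.
exact: (cf _ (@open_gt _ r)).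
Qed.

Lemma mdist_borel_measurable :
  measurable_fun setT ((fun z => mdist z.1 z.2) : borelType (T * T)%type -> R).
Proof.
have /continuousP cf := @mdist_continuous R T.
apply: measurable_fun_g_sigma => r; exact: (cf _ (@open_gt _ r)).
Qed.

Lemma fst_borel_measurable :
  measurable_fun setT (fst : borelType (T * T)%type -> bT).
Proof.
apply: (measurability _ (erefl : @measurable _ bT = <<s @open T >>)).
move=> _ [U oU <-]; rewrite setTI; apply: sub_sigma_algebra.
suff /continuousP h : continuous (@fst T T) by exact: h.
by move=> z; exact: cvg_fst.
Qed.

Lemma snd_borel_measurable :
  measurable_fun setT (snd : borelType (T * T)%type -> bT).
Proof.
apply: (measurability _ (erefl : @measurable _ bT = <<s @open T >>)).
move=> _ [U oU <-]; rewrite setTI; apply: sub_sigma_algebra.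
suff /continuousP h : continuous (@snd T T) by exact: h.
by move=> z; exact: cvg_snd.
Qed.

Lemma setX_borel_measurable (A B : set bT) : measurable A -> measurable B ->
  measurable (A `*` B : set (borelType (T * T)%type)).
Proof.
move=> mA mB.
have := measurableI _ _ (fst_borel_measurable measurableT mA)
                        (snd_borel_measurable measurableT mB).
by rewrite !setTI.
Qed.

(** Compact sets carrying all but [e] of each measure are covered by finitely many balls of radius
    [e]; [q] picks the first ball containing the point, and [ord_max] collects the points in none of
    them. *)
Lemma exists_quantizer (mu nu : probability bT R) (a : nat -> T) (e : R) :
  (forall x (r : R), 0 < r -> exists n, mdist (a n) x < r) -> 0 < e ->
  exists N (q : T -> 'I_N.+1), [/\
    forall i, measurable (q @^-1` [set i] : set bT),
    forall x, q x != ord_max -> mdist (a (q x)) x < e,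
    fine (mu (q @^-1` [set ord_max])) <= e &
    fine (nu (q @^-1` [set ord_max])) <= e].
Proof.
move=> ad e0.
have [K [cK _ Ke]] :=
  borel_inner_regular T_lcompact T_separable mu measurableT e0.
have [H [cH _ He]] :=
  borel_inner_regular T_lcompact T_separable nu measurableT e0.
pose b i := [set x | mdist (a i) x < e].
have [N Nb] : exists N, forall x, (K `|` H) x -> exists2 i, (i < N)%N & b i x.
  have /compact_near_coveringP := compactU cK cH.
  move=> /(_ nat \oo (fun N x => exists2 i, (i < N)%N & b i x) _)[|N _ h].
    move=> x _; have [n nx] := ad x _ e0.
    exists (b n, [set m | (n < m)%N]) => /=.
      split; last by exists n.+1.
      by apply: open_nbhs_nbhs; split => //; exact: open_mdist_lt.
    by move=> [y m] /= [b_y nm]; exists n.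
  by exists N => x; exact: (h N (leqnn _)).
(* [find] returns [N] when no ball contains [x], so the leftover points get the index [ord_max]. *)
pose p x := find (fun n => mdist (a n) x < e) (iota 0 N).
have pN x : (p x <= N)%N by rewrite -[leqRHS](size_iota 0) find_size.
have pb x : (p x < N)%N -> b (p x) x.
  move=> px; have := @nth_find _ 0%N (fun n => mdist (a n) x < e) (iota 0 N).
  by rewrite nth_iota// has_find size_iota; exact.
have pNb x k : (k < p x)%N -> ~ b k x.
  move=> kp; have := before_find 0%N kp.
  rewrite nth_iota ?add0n /b /= => [->//|].
  exact: leq_trans kp _.
pose q x : 'I_N.+1 := inord (p x).
have qE x : q x = p x :> nat by rewrite inordK// ltnS.
have mb i : measurable (b i : set bT).
  by apply: open_borel; exact: open_mdist_lt.
exists N, q.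
have mq i : measurable (q @^-1` [set i] : set bT).
  (* A cell is its ball minus the earlier balls; for [i = N] there is no ball and [setT] takes its
     place. *)
  rewrite (_ : _ @^-1` _ =
    (if (i < N)%N then b i else setT) `\` \bigcup_(k < i) b k).
    apply: measurableD; first by case: ifP.
    by apply: bigcup_measurable => k _.
  apply/seteqP; split=> [x /= qx|x [bi bk]].
    have pi : p x = i by rewrite -qE qx.
    split; first by rewrite -pi; case: ifPn => // /pb.
    by move=> [k /= ki]; apply: pNb; rewrite pi.
  apply/val_inj; rewrite /= qE; have [pi|ip|//] := ltngtP (p x) i.
    exfalso; apply: bk; exists (p x) => //; apply: pb.
    by rewrite (leq_trans pi)// -ltnS.
  exfalso; apply: (pNb _ _ ip); move: bi; rewrite ifT//.
  exact: leq_trans ip (pN x).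
have qlt x : (q x != ord_max) = (p x < N)%N.
  by rewrite -val_eqE /= qE ltn_neqAle pN andbT.
have qK x : (K `|` H) x -> q x != ord_max.
  move=> /Nb[i iN bi]; rewrite qlt ltnNge; apply/negP => Np.
  by apply: (pNb x i) => //; exact: leq_trans iN Np.
have fle (m : probability bT R) (C D : set bT) : measurable C -> measurable D ->
    C `<=` D -> (m D <= e%:E)%E -> fine (m C) <= e.
  move=> mC mD CD De; rewrite -lee_fin fineK ?fin_num_measure//.
  by apply: le_trans De; apply: le_measure; rewrite ?inE.
split => //.
- by move=> x; rewrite qlt => /pb; rewrite /b/= qE.
- apply: fle Ke => //; first by apply: measurableD => //; exact: compact_borel.
  move=> x /= qx; split => // Kx.
  by have := qK x (or_introl Kx); rewrite qx eqxx.
- apply: fle He => //; first by apply: measurableD => //; exact: compact_borel.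
  move=> x /= qx; split => // Kx.
  by have := qK x (or_intror Kx); rewrite qx eqxx.
Qed.

Section transport_cost_bound.
Variables mu nu : probability bT R.
Variable L : (T * T -> R) -> R.
Hypothesis LP : positive_functional L.
Hypothesis Lmu : forall A : set bT, measurable A ->
  L (fun z => \1_A z.1) = fine (mu A).
Hypothesis Lnu : forall A : set bT, measurable A ->
  L (fun z => \1_A z.2) = fine (nu A).
Variable pi : probability (borelType (T * T)%type) R.
Hypothesis piX : forall A B : set bT, measurable A -> measurable B ->
  pi (A `*` B) = (L \1_(A `*` B))%:E.
Hypothesis T_bounded : bounded_space T.

Lemma bounded_fct_mdist : bounded_fct (fun z : T * T => mdist z.1 z.2).
Proof.
by have [D bD] := T_bounded; exists D => z; rewrite ger0_norm ?mdist_ge0.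
Qed.

(** A step function [s] on products of cells dominates the distance, has the same value under [pi]
    and [L] because they agree on rectangles, and exceeds the distance only by terms that [L]
    controls through its marginals. *)
Lemma transport_cost_le :
  (transport_cost pi <= (L (fun z => mdist z.1 z.2))%:E)%E.
Proof.
have [D bD] := T_bounded.
have D0 : 0 <= D := le_trans (mdist_ge0 point point) (bD point point).
have [a ad] := separable_seq T_separable.
(* The factor collects [2 * e] from the definition of [s], [2 * e] from comparing centres with
   points, and [D * e] from the leftover cell of each coordinate. *)
suff h (e : R) : 0 < e ->
    (transport_cost pi <= (L (fun z => mdist z.1 z.2) + (4 + 2 * D) * e)%:E)%E.
  apply/lee_addgt0Pr => e e0.
  have k0 : 0 < 4 + 2 * D by lra.
  have /h := divr_gt0 e0 k0; rewrite mulrC divfK ?gt_eqF//; exact.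
move=> e0; have [N [q [mq qe mue nue]]] := exists_quantizer mu nu ad e0.
pose c (k : 'I_N.+1 * 'I_N.+1) : R :=
  if (k.1 != ord_max) && (k.2 != ord_max) then mdist (a k.1) (a k.2) + 2 * e
  else D.
have c0 k : 0 <= c k.
  rewrite /c; case: ifP => // _; have := mdist_ge0 (a k.1) (a k.2); lra.
pose Q (k : 'I_N.+1 * 'I_N.+1) : set (T * T) :=
  (q @^-1` [set k.1]) `*` (q @^-1` [set k.2]).
pose s : T * T -> R := \sum_(k : 'I_N.+1 * 'I_N.+1) c k *: \1_(Q k).
have sE z : s z = c (q z.1, q z.2).
  rewrite /s fct_sumE (bigD1 (q z.1, q z.2))//= big1 ?addr0.
    by rewrite scale_fctE indicE mem_set ?mulr1.
  move=> [i j] /= nij.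
  rewrite scale_fctE indicE memNset ?mulr0// => -[/= qi qj].
  by move: nij; rewrite qi qj eqxx.
have bI Z : bounded_fct (\1_Z : T * T -> R) by exact: bounded_fct_indic.
have bcI k : bounded_fct (c k *: \1_(Q k)) by exact: bounded_fctZ.
have [bs Ls] := functional_sum LP (index_enum ('I_N.+1 * 'I_N.+1)%type) bcI.
have mQ k : measurable (Q k : set (borelType (T * T)%type)).
  exact: setX_borel_measurable.
have mI k : measurable_fun setT (\1_(Q k) : borelType (T * T)%type -> R).
  exact: measurable_indic.
have ms : measurable_fun setT (s : borelType (T * T)%type -> R).
  rewrite (_ : s = fun z => \sum_k (c k * \1_(Q k) z)); last first.
    by apply/funext => z; rewrite /s fct_sumE.
  apply: measurable_sum => k; exact: measurable_funM.
have ints : (\int[pi]_z (s z)%:E = (L s)%:E)%E.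
  under eq_integral do rewrite /s fct_sumE -sumEFin.
  rewrite ge0_integral_sum//=; last 2 first.
  - move=> k; apply/measurable_EFinP; exact: measurable_funM.
  - by move=> k z _; rewrite lee_fin mulr_ge0// indicE.
  rewrite Ls -sumEFin; apply: eq_bigr => k _.
  under eq_integral do rewrite EFinM.
  rewrite ge0_integralZl//=; last 2 first.
  - exact/measurable_EFinP.
  - by rewrite lee_fin.
  rewrite integral_indic// setIT (functionalZ LP)// EFinM; congr (_ * _)%E.
  exact: piX.
have cost_s : (transport_cost pi <= (L s)%:E)%E.
  rewrite /transport_cost -ints; apply: ge0_le_integral => //=.
  - by move=> z _; rewrite lee_fin mdist_ge0.
  - by apply/measurable_EFinP; exact: mdist_borel_measurable.
  - exact/measurable_EFinP.
  move=> z _; rewrite lee_fin sE /c /=; case: ifP => [/andP[q1 q2]|//].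
  have := metric_triangle z.1 (a (q z.1)) z.2.
  have := metric_triangle (a (q z.1)) (a (q z.2)) z.2.
  have := qe _ q1; have := qe _ q2; rewrite (metric_sym z.1 (a _)); lra.
apply: le_trans cost_s _; rewrite lee_fin.
pose C : set bT := q @^-1` [set ord_max].
have L1 : L (fun=> 1) = 1.
  transitivity (fine (mu setT)); last by rewrite probability_setT.
  by rewrite -Lmu//; congr L; apply/funext => z; rewrite indicE in_setT.
have b1 : bounded_fct (fun z : T * T => \1_C z.1 : R).
  by have [M h] := @bounded_fct_indic R T C; exists M => z; exact: h.
have b2 : bounded_fct (fun z : T * T => \1_C z.2 : R).
  by have [M h] := @bounded_fct_indic R T C; exists M => z; exact: h.
have bd := bounded_fct_mdist.
have b1' := bounded_fctZ D b1; have b2' := bounded_fctZ D b2.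
have bc := bounded_fctZ (4 * e) (@bounded_fct_cst R (T * T)%type 1).
have b3 := bounded_fctD bd bc; have b4 := bounded_fctD b3 b1'.
have sle := functional_le LP bs (bounded_fctD b4 b2').
apply: le_trans (sle _) _ => [z|].
  rewrite -/s sE !add_fctE !scale_fctE mulr1 /c /= !indicE.
  have := mdist_ge0 z.1 z.2.
  have i0 (B : bool) : 0 <= D * B%:R by rewrite mulr_ge0.
  case: ifP => [/andP[q1 q2] _|/negbT].
    have := metric_triangle (a (q z.1)) z.1 (a (q z.2)).
    have := metric_triangle z.1 z.2 (a (q z.2)).
    have := i0 (z.1 \in C); have := i0 (z.2 \in C).
    have := qe _ q1; have := qe _ q2; rewrite (metric_sym z.2 (a _)); lra.
  rewrite negb_and !negbK => /orP[/eqP qz|/eqP qz] dz.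
    have -> : z.1 \in C by rewrite inE.
    have := i0 (z.2 \in C); rewrite mulr1; lra.
  have -> : z.2 \in C by rewrite inE.
  have := i0 (z.1 \in C); rewrite mulr1; lra.
rewrite !(functionalD LP)// !(functionalZ LP)//; last exact: bounded_fct_cst.
have mC : measurable C by exact: mq.
rewrite L1 (Lmu mC) (Lnu mC) mulr1 -!addrA lerD2l.
have := ler_wpM2l D0 mue; have := ler_wpM2l D0 nue; lra.
Qed.

End transport_cost_bound.

End quantization.

(** * Duality *)

Section bounded_borel.
Context {R : realType} d (X : measurableType d) (m : probability X R).
Implicit Types f g : X -> R.

Definition bounded_mfun f := measurable_fun setT f /\ bounded_fct f.

Lemma bounded_mfunD f g : bounded_mfun f -> bounded_mfun g ->
  bounded_mfun (fun x => f x + g x).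
Proof.
move=> [mf bf] [mg bg]; split; first exact: measurable_funD.
exact: (bounded_fctD bf bg).
Qed.

Lemma bounded_mfunZ t f : bounded_mfun f -> bounded_mfun (fun x => t * f x).
Proof.
move=> [mf bf]; split; first exact: measurable_funM.
exact: (bounded_fctZ t bf).
Qed.

Lemma bounded_mfun_cst c : bounded_mfun (fun=> c).
Proof. by split => //; exact: bounded_fct_cst. Qed.

Lemma bounded_mfun_indic A : measurable A -> bounded_mfun (\1_A).
Proof.
by move=> mA; split; [exact: measurable_indic|exact: bounded_fct_indic].
Qed.

Lemma bounded_mfun_integrable f : bounded_mfun f ->
  m.-integrable setT (EFin \o f).
Proof.
move=> [mf [M bM]]; apply: measurable_bounded_integrable => //.
  by rewrite (le_lt_trans (probability_le1 _ _))// ltry.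
exists M; split; first exact: num_real.
by move=> N MN x _; exact: le_trans (bM x) (ltW MN).
Qed.

Lemma bounded_mfun_integral f : bounded_mfun f ->
  (\int[m]_x (f x)%:E)%E = (\int[m]_x f x)%:E.
Proof.
move=> /bounded_mfun_integrable fi; rewrite /Rintegral fineK//.
exact: integrable_fin_num.
Qed.

Lemma probability_RintegralD f g : bounded_mfun f -> bounded_mfun g ->
  \int[m]_x (f x + g x) = \int[m]_x f x + \int[m]_x g x.
Proof.
by move=> bf bg; apply: RintegralD => //; exact: bounded_mfun_integrable.
Qed.

Lemma probability_RintegralZ t f : bounded_mfun f ->
  \int[m]_x (t * f x) = t * \int[m]_x f x.
Proof.
by move=> bf; apply: RintegralZl => //; exact: bounded_mfun_integrable.
Qed.

Lemma probability_Rintegral_cst c : \int[m]_x c = c.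
Proof.
transitivity (c * fine (m setT)); first exact: Rintegral_cst.
by rewrite probability_setT mulr1.
Qed.

Lemma probability_le_Rintegral f g : bounded_mfun f -> bounded_mfun g ->
  (forall x, f x <= g x) -> \int[m]_x f x <= \int[m]_x g x.
Proof.
by move=> bf bg fg; apply: le_Rintegral => //; exact: bounded_mfun_integrable.
Qed.

Lemma probability_Rintegral_indic A : measurable A ->
  \int[m]_x (\1_A x : R) = fine (m A).
Proof. by move=> mA; rewrite /Rintegral integral_indic// setIT. Qed.

End bounded_borel.

(** * The upper integral by separable majorants *)

Section marginal_upper_integral.
Context {R : realType} {T : pmetricType R}.
Variables mu nu : probability (borelType T) R.
Implicit Types h : T * T -> R.

Local Notation bT := (borelType T).

Definition majorants h := [set fg : (bT -> R) * (bT -> R) |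
  [/\ bounded_mfun fg.1, bounded_mfun fg.2 &
      forall x y, h (x, y) <= fg.1 x + fg.2 y]].

Definition upper_integral h : R :=
  inf [set \int[mu]_x fg.1 x + \int[nu]_x fg.2 x | fg in majorants h].

Let bounded_mfunN (f : bT -> R) :
  bounded_mfun f -> bounded_mfun (fun x => - f x).
Proof.
move=> /(bounded_mfunZ (-1)); congr bounded_mfun; apply/funext => x.
by rewrite mulN1r.
Qed.

(** The inequality [c <= f x + g y] is integrated in [x] for fixed [y], then in [y]; constants are
    rewritten as their integrals. *)
Lemma majorant_ge h c fg : (forall z, c <= h z) -> majorants h fg ->
  c <= \int[mu]_x fg.1 x + \int[nu]_x fg.2 x.
Proof.
move=> ch [bf bg hfg].
rewrite -(@probability_Rintegral_cst _ _ _ nu (\int[mu]_x fg.1 x)).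
rewrite -probability_RintegralD//; last exact: bounded_mfun_cst.
rewrite -[leLHS](@probability_Rintegral_cst _ _ _ nu c).
apply: probability_le_Rintegral; first exact: bounded_mfun_cst.
  by apply: bounded_mfunD => //; exact: bounded_mfun_cst.
move=> y; rewrite -[X in _ <= _ + X](@probability_Rintegral_cst _ _ _ mu).
rewrite -probability_RintegralD//; last exact: bounded_mfun_cst.
rewrite -[leLHS](@probability_Rintegral_cst _ _ _ mu c).
apply: probability_le_Rintegral; first exact: bounded_mfun_cst.
  by apply: bounded_mfunD => //; exact: bounded_mfun_cst.
by move=> x; exact: le_trans (ch _) (hfg x y).
Qed.

Lemma majorants_has_inf h : bounded_fct h ->
  has_inf [set \int[mu]_x fg.1 x + \int[nu]_x fg.2 x | fg in majorants h].
Proof.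
move=> [M bM]; split.
  exists (\int[mu]_x M + \int[nu]_x 0), (fun=> M, fun=> 0) => //=.
  split; [exact: bounded_mfun_cst..|move=> x y /=].
  by rewrite addr0; apply: le_trans (bM _); exact: ler_norm.
exists (- M) => _ [fg mfg <-]; apply: majorant_ge mfg => z.
by have := bM z; rewrite ler_norml => /andP[].
Qed.

Lemma upper_integral_le h (f g : bT -> R) : bounded_fct h -> bounded_mfun f ->
  bounded_mfun g -> (forall x y, h (x, y) <= f x + g y) ->
  upper_integral h <= \int[mu]_x f x + \int[nu]_x g x.
Proof.
move=> bh bf bg hfg; apply: ge_inf; first exact: (majorants_has_inf bh).2.
by exists (f, g).
Qed.

Lemma le_upper_integral h c : bounded_fct h ->
  (forall fg, majorants h fg -> c <= \int[mu]_x fg.1 x + \int[nu]_x fg.2 x) ->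
  c <= upper_integral h.
Proof.
move=> bh ch; apply: lb_le_inf; first exact: (majorants_has_inf bh).1.
by move=> _ [fg mfg <-]; exact: ch.
Qed.

Lemma upper_integral_sublinear : sublinear bounded_fct upper_integral.
Proof.
apply: sublinear_le => [t h|h1 h2 b1 b2|t h t0 bh]; first exact: bounded_fctZ.
- rewrite -lerBlDr; apply: le_upper_integral => // -[f1 g1] [bf1 bg1 h1fg].
  rewrite lerBlDr -lerBlDl; apply: le_upper_integral => //.
  move=> -[f2 g2] [bf2 bg2 h2fg].
  rewrite /= in bf1 bg1 h1fg bf2 bg2 h2fg *.
  rewrite lerBlDl addrACA -!probability_RintegralD//.
  apply: upper_integral_le; [exact: bounded_fctD|exact: bounded_mfunD..|].
  by move=> x y; rewrite add_fctE addrACA lerD.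
- have [->|tn0] := eqVneq t 0.
    rewrite mul0r scale0r.
    have b0 : bounded_fct (0 : T * T -> R) by exact: bounded_fct_cst.
    apply: le_trans (@upper_integral_le _ (fun=> 0) (fun=> 0) _ _ _ _) _ => //.
    + exact: bounded_mfun_cst.
    + exact: bounded_mfun_cst.
    + by move=> x y; rewrite addr0.
    + by rewrite !probability_Rintegral_cst addr0.
  have {tn0} t0' : 0 < t by rewrite lt_neqAle eq_sym tn0.
  rewrite -ler_pdivrMl//; apply: le_upper_integral => // -[f g] [/= bf bg hfg].
  rewrite ler_pdivrMl// mulrDr -!probability_RintegralZ//.
  apply: upper_integral_le; [exact: bounded_fctZ|exact: bounded_mfunZ..|].
  by move=> x y; rewrite scale_fctE -mulrDr ler_wpM2l.
Qed.

(* [- upper_integral (- h)] is the supremum of the sums of the integrals of f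
   and g over the pairs with f x + g y <= h (x, y), i.e. the dual value. *)
Lemma exists_marginal_functional h : bounded_fct h ->
  exists L : (T * T -> R) -> R, [/\ positive_functional L,
    forall A : set bT, measurable A -> L (fun z => \1_A z.1) = fine (mu A),
    forall A : set bT, measurable A -> L (fun z => \1_A z.2) = fine (nu A) &
    L h <= - upper_integral (- h)].
Proof.
move=> bh.
have bN (f : T * T -> R) : bounded_fct f -> bounded_fct (- f).
  by move=> bf; rewrite -scaleN1r; exact: bounded_fctZ.
(* Forcing the value at [- h] makes [L] reach [upper_integral (- h)] there, which is the last claim
   after a change of sign. *)
have [L [LD LZ Lp Lh]] := exists_linear_below (@bounded_fctD R _)
  (@bounded_fctZ R _) upper_integral_sublinear (bN _ bh).
have LN f : bounded_fct f -> L (- f) = - L f.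
  by move=> bf; rewrite -scaleN1r LZ// mulN1r.
(* The pair [(f, 0)] majorises [f z.1], which bounds the marginal above; the same bound for [- f]
   later gives equality. *)
have L1 (f : bT -> R) : bounded_mfun f -> L (fun z => f z.1) <= \int[mu]_x f x.
  move=> bf.
  have bf1 : bounded_fct (fun z : T * T => f z.1).
    by have [_ [M bM]] := bf; exists M => z.
  apply: le_trans (Lp _ bf1) _.
  rewrite -[leRHS]addr0 -(@probability_Rintegral_cst _ _ _ nu 0).
  apply: upper_integral_le => //; first exact: bounded_mfun_cst.
  by move=> x y; rewrite addr0.
have L2 (f : bT -> R) : bounded_mfun f -> L (fun z => f z.2) <= \int[nu]_x f x.
  move=> bf.
  have bf2 : bounded_fct (fun z : T * T => f z.2).
    by have [_ [M bM]] := bf; exists M => z.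
  apply: le_trans (Lp _ bf2) _.
  rewrite -[leRHS]add0r -(@probability_Rintegral_cst _ _ _ mu 0).
  apply: upper_integral_le => //; first exact: bounded_mfun_cst.
  by move=> x y; rewrite add0r.
have IN (m : probability bT R) (f : bT -> R) : bounded_mfun f ->
    \int[m]_x (- f x) = - \int[m]_x f x.
  move=> bf; rewrite -mulN1r -probability_RintegralZ//.
  by apply: eq_Rintegral => x _; rewrite mulN1r.
exists L; split.
(* Positivity: for [f >= 0] the pair of zero functions majorises [- f]. *)
- split=> // f bf f0; rewrite -oppr_le0 -LN//.
  apply: le_trans (Lp _ (bN _ bf)) _.
  apply: le_trans (@upper_integral_le _ (fun=> 0) (fun=> 0) (bN _ bf) _ _ _) _.
  + exact: bounded_mfun_cst.
  + exact: bounded_mfun_cst.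
  + by move=> x y; rewrite addr0 oppr_le0.
  + by rewrite !probability_Rintegral_cst addr0.
- move=> A mA; have bA := bounded_mfun_indic mA (R := R).
  rewrite -probability_Rintegral_indic//; apply/eqP; rewrite eq_le L1//=.
  rewrite -lerN2 -IN// -LN; last by have [_ [M bM]] := bA; exists M => z.
  exact: (L1 _ (bounded_mfunN bA)).
- move=> A mA; have bA := bounded_mfun_indic mA (R := R).
  rewrite -probability_Rintegral_indic//; apply/eqP; rewrite eq_le L2//=.
  rewrite -lerN2 -IN// -LN; last by have [_ [M bM]] := bA; exists M => z.
  exact: (L2 _ (bounded_mfunN bA)).
- by rewrite lerNr -LN.
Qed.

End marginal_upper_integral.

(** * Limits superior of bounded real sequences *)

Section eventual_sup.
Context {R : realType}.
Implicit Types (u v : nat -> R) (c D : R).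

(** For bounded [u] this is the limit superior, written so as to stay in the reals. *)
Definition eventual_sup u : R :=
  inf [set b | exists j, forall n, (j <= n)%N -> u n <= b].

Let has_inf_eventual u D : (forall n, `|u n| <= D) ->
  has_inf [set b | exists j, forall n, (j <= n)%N -> u n <= b].
Proof.
move=> uD; split.
  by exists D, 0%N => n _; apply: le_trans (uD n); exact: ler_norm.
exists (- D) => b [j /(_ j (leqnn _)) jb].
by apply: le_trans jb; have := uD j; rewrite ler_norml => /andP[].
Qed.

(** An eventual bound of [v], raised by [c], is one of [u]. Only the indices from [k] on matter, as
    the tail estimate in [potential_attained] requires. *)
Lemma eventual_sup_le u v D (D' : R) c k : (forall n, `|u n| <= D) ->
  (forall n, `|v n| <= D') -> (forall n, (k <= n)%N -> u n <= v n + c) ->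
  eventual_sup u <= eventual_sup v + c.
Proof.
move=> uD vD uv; rewrite -lerBlDr.
apply: lb_le_inf; first exact: (has_inf_eventual vD).1.
move=> b [j jb]; rewrite lerBlDr; apply: ge_inf.
  exact: (has_inf_eventual uD).2.
exists (maxn j k) => n; rewrite geq_max => /andP[jn kn].
by apply: le_trans (uv n kn) _; rewrite lerD2r jb.
Qed.

Lemma eventual_sup_cst c : eventual_sup (fun=> c) = c.
Proof.
apply/eqP; rewrite eq_le; apply/andP; split.
  apply: ge_inf; first by exists c => b [j /(_ j (leqnn _))].
  by exists 0%N.
apply: lb_le_inf; first by exists c, 0%N.
by move=> b [j /(_ j (leqnn _))].
Qed.

Lemma eventual_sup_norm_le u D :
  (forall n, `|u n| <= D) -> `|eventual_sup u| <= D.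
Proof.
move=> uD; have D0 : 0 <= D by apply: le_trans (uD 0%N).
have cD n : `|(fun=> 0 : R) (n : nat)| <= 0 by rewrite normr0.
rewrite ler_norml; apply/andP; split.
  rewrite -subr_ge0 opprK -[leLHS](eventual_sup_cst 0).
  apply: (@eventual_sup_le _ _ 0 D _ 0) => // n _.
  by rewrite -lerBlDr sub0r; have := uD n; rewrite ler_norml => /andP[].
rewrite -[leRHS]add0r -(eventual_sup_cst 0).
apply: (@eventual_sup_le _ _ D 0 _ 0) => // n _.
by rewrite add0r; apply: le_trans (uD n); exact: ler_norm.
Qed.

End eventual_sup.

(** * Potentials, weak duality and attainment *)

Section duality.
Context {R : realType} {T : pmetricType R}.
Variables mu nu : probability (borelType T) R.
Hypothesis T_bounded : bounded_space T.

Local Notation bT := (borelType T).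
Local Notation bTT := (borelType (T * T)%type).
Local Notation dist := (fun z : T * T => mdist z.1 z.2).

Lemma bounded_continuous_fct (u : T -> R) :
  continuous u -> bounded_fct u -> bounded_continuous u.
Proof.
move=> cu [M bM]; split => //; exists M; split; first exact: num_real.
by move=> N MN x _; exact: le_trans (bM x) (ltW MN).
Qed.

Lemma bounded_continuous_mfun (u : T -> R) :
  bounded_continuous u -> bounded_mfun (u : bT -> R).
Proof.
move=> [cu [M [_ bM]]]; split; first exact: continuous_borel_measurable.
by exists (M + 1) => x; apply: (bM (M + 1)) => //; rewrite ltrDl.
Qed.

Lemma integral_diffE (u : bT -> R) : bounded_mfun u ->
  integral_diff mu nu u = (\int[mu]_x u x - \int[nu]_x u x)%:E.
Proof. by move=> bu; rewrite /integral_diff !bounded_mfun_integral. Qed.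

Lemma bounded_mfun_mdist : bounded_mfun (dist : bTT -> R).
Proof. by split; [exact: mdist_borel_measurable|exact: bounded_fct_mdist]. Qed.

(** The transform [u x = inf_y (d (x, y) + g y)] is 1-Lipschitz as an infimum of 1-Lipschitz
    functions. Taking [y = x] gives [u <= g] and the majorant condition gives [- f <= u], so [u]
    alone does at least as well as the pair. *)
Lemma exists_potential (fg : (bT -> R) * (bT -> R)) : majorants (- dist) fg ->
  exists u : T -> R, [/\ bounded_continuous u, lipschitz1 u &
    - (\int[mu]_x fg.1 x + \int[nu]_x fg.2 x) <=
    \int[mu]_x (u x : R) - \int[nu]_x (u x : R)].
Proof.
case: fg => f g [/= [mf [N bN]] [mg [M bM]] dfg].
pose S x := [set mdist x y + g y | y in [set: T]].
pose u x := inf (S x).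
have Sinf x : has_inf (S x).
  split; first by exists (mdist x x + g x), x.
  exists (- M) => _ [y _ <-]; have := bM y; rewrite ler_norml => /andP[+ _].
  by have := mdist_ge0 x y; lra.
have ule x y : u x <= mdist x y + g y.
  by apply: ge_inf; [exact: (Sinf x).2|exists y].
have leu x c : (forall y, c <= mdist x y + g y) -> c <= u x.
  by move=> cy; apply: lb_le_inf; [exact: (Sinf x).1|move=> _ [y _ <-]].
have ug x : u x <= g x by have := ule x x; rewrite mdistxx add0r.
have fu x : - f x <= u x.
  by apply: leu => y; have : - mdist x y <= f x + g y := dfg x y; lra.
have uM x : - M <= u x.
  apply: leu => y; have := bM y; rewrite ler_norml => /andP[+ _].
  by have := mdist_ge0 x y; lra.
have ulip1 x y : u x - u y <= mdist x y.
  rewrite lerBlDr -lerBlDl; apply: leu => z.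
  by have := ule x z; have := metric_triangle x y z; lra.
have ulip : lipschitz1 u.
  by move=> x y; rewrite ler_norml lerNl opprB ulip1 metric_sym ulip1.
have bu : bounded_continuous u.
  apply: bounded_continuous_fct; first exact: lipschitz1_continuous.
  exists M => x; rewrite ler_norml uM; apply: le_trans (ug x) _.
  by apply: le_trans (bM x); exact: ler_norm.
exists u; split => //; have bmu := bounded_continuous_mfun bu.
rewrite opprD; apply: lerB.
  rewrite -mulN1r -probability_RintegralZ//; last by split => //; exists N.
  apply: probability_le_Rintegral => //.
    by apply: bounded_mfunZ; split => //; exists N.
  by move=> x; rewrite mulN1r.
by apply: probability_le_Rintegral => //; split => //; exists M.
Qed.

Section coupling.
Variable pi : probability bTT R.
Hypothesis pi_coupling : couplings mu nu pi.

Lemma bounded_mfun_fst (u : bT -> R) :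
  bounded_mfun u -> bounded_mfun (fun z : bTT => u z.1).
Proof.
move=> [mu' [M bM]]; split; last by exists M => z.
by apply: (measurableT_comp mu'); exact: fst_borel_measurable.
Qed.

Lemma bounded_mfun_snd (u : bT -> R) :
  bounded_mfun u -> bounded_mfun (fun z : bTT => u z.2).
Proof.
move=> [mu' [M bM]]; split; last by exists M => z.
by apply: (measurableT_comp mu'); exact: snd_borel_measurable.
Qed.

Lemma coupling_fst (u : bT -> R) : bounded_mfun u ->
  \int[mu]_x u x = \int[pi]_z u z.1.
Proof.
move=> bu; rewrite /Rintegral; congr fine.
have mu_ : measurable_fun setT (EFin \o u) by apply/measurable_EFinP; case: bu.
have iu := bounded_mfun_integrable pi (bounded_mfun_fst bu).
have := integral_pushforward fst_borel_measurable mu_ iu measurableT.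
rewrite preimage_setT => <-.
apply: eq_measure_integral => [|? A mA _]; first exact: fst_borel_measurable.
by have [] := pi_coupling mA.
Qed.

Lemma coupling_snd (u : bT -> R) : bounded_mfun u ->
  \int[nu]_x u x = \int[pi]_z u z.2.
Proof.
move=> bu; rewrite /Rintegral; congr fine.
have mu_ : measurable_fun setT (EFin \o u) by apply/measurable_EFinP; case: bu.
have iu := bounded_mfun_integrable pi (bounded_mfun_snd bu).
have := integral_pushforward snd_borel_measurable mu_ iu measurableT.
rewrite preimage_setT => <-.
apply: eq_measure_integral => [|? A mA _]; first exact: snd_borel_measurable.
by have [] := pi_coupling mA.
Qed.

(** The defect in the dual constraint; by [integral_diff_slack] its integral against a coupling is
    the duality gap of [u]. *)
Definition slack (u : T -> R) (z : T * T) : R :=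
  mdist z.1 z.2 - (u z.1 - u z.2).

Lemma slack_ge0 u z : lipschitz1 u -> 0 <= slack u z.
Proof.
by move=> u1; rewrite subr_ge0; apply: le_trans (u1 _ _); exact: ler_norm.
Qed.

Lemma bounded_mfun_slack u : bounded_mfun (u : bT -> R) ->
  bounded_mfun (slack u : bTT -> R).
Proof.
move=> bu; have b1 := bounded_mfun_fst bu; have b2 := bounded_mfun_snd bu.
have := bounded_mfunD bounded_mfun_mdist
  (bounded_mfunD (bounded_mfunZ (-1) b1) b2).
by congr bounded_mfun; apply/funext => z;
  rewrite /slack mulN1r opprB (addrC (- _)).
Qed.

(** The marginals turn the integral of [u] against [mu - nu] into the integral of [u z.1 - u z.2]
    against [pi]. *)
Lemma integral_diff_slack u : bounded_mfun (u : bT -> R) ->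
  (integral_diff mu nu u + \int[pi]_z (slack u z)%:E = transport_cost pi)%E.
Proof.
move=> bu; have b1 := bounded_mfun_fst bu; have b2 := bounded_mfun_snd bu.
have bs := bounded_mfun_slack bu.
rewrite integral_diffE// (coupling_fst bu) (coupling_snd bu).
rewrite (bounded_mfun_integral pi bs) /transport_cost.
rewrite (bounded_mfun_integral pi bounded_mfun_mdist) -EFinD; congr EFin.
rewrite -mulN1r -probability_RintegralZ// -probability_RintegralD//;
  last exact: bounded_mfunZ.
rewrite -probability_RintegralD//.
  by apply: eq_Rintegral => z _; rewrite /slack; lra.
by apply: bounded_mfunD => //; exact: bounded_mfunZ.
Qed.

Lemma weak_duality u : bounded_continuous u -> lipschitz1 u ->
  (integral_diff mu nu u <= transport_cost pi)%E.
Proof.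
move=> bu u1; rewrite -(integral_diff_slack (bounded_continuous_mfun bu)).
by rewrite leeDl// integral_ge0// => z _; rewrite lee_fin slack_ge0.
Qed.

(** A majorant pair within [e] of the infimum yields a potential of value at least
    [- upper_integral (- d) - e], hence at least the cost of [pi] minus [e]. *)
Lemma approximate_potential :
  (transport_cost pi <= (- upper_integral mu nu (- dist))%:E)%E ->
  forall e : R, 0 < e -> exists u, [/\ bounded_continuous u, lipschitz1 u &
    (\int[pi]_z (slack u z)%:E <= e%:E)%E].
Proof.
move=> cost_le e e0.
have bN : bounded_fct (- dist).
  by rewrite -scaleN1r; apply: bounded_fctZ; exact: bounded_fct_mdist.
have [_ [fg mfg <-] fge] := inf_adherent e0 (majorants_has_inf mu nu bN).
have [u [bu u1 ufg]] := exists_potential mfg.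
exists u; split => //; have bmu := bounded_continuous_mfun bu.
have := integral_diff_slack bmu; rewrite integral_diffE//.
rewrite (bounded_mfun_integral pi (bounded_mfun_slack bmu)).
move: cost_le; rewrite /transport_cost.
rewrite (bounded_mfun_integral pi bounded_mfun_mdist).
rewrite lee_fin => cost_le; rewrite -EFinD => -[gap].
move: fge; rewrite -/(upper_integral mu nu (- dist)) lee_fin; lra.
Qed.

(* The eventual supremum g of a maximising sequence is optimal: pointwise, and
   for every k, [slack g <= \sum_(n >= k) slack (u n)], whose integral is at
   most 2^-k. *)
Lemma potential_attained :
  (forall e : R, 0 < e -> exists u, [/\ bounded_continuous u, lipschitz1 u &
    (\int[pi]_z (slack u z)%:E <= e%:E)%E]) ->
  exists u, [/\ bounded_continuous u, lipschitz1 u &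
    integral_diff mu nu u = transport_cost pi].
Proof.
move=> approx; have [D bD] := T_bounded.
have e0 n : 0 < (2 ^ n.+1)%:R^-1 :> R by rewrite invr_gt0 ltr0n expn_gt0.
have /choice[v vP] n : exists w : T -> R, [/\ lipschitz1 w, w point = 0 &
    (\int[pi]_z (slack w z)%:E <= (2 ^ n.+1)%:R^-1%:E)%E].
  have [u [bu u1 ule]] := approx _ (e0 n).
  (* Normalising at [point] leaves the slack unchanged and bounds all potentials by [D], so that the
     eventual suprema are finite. *)
  exists (fun x => u x - u point); split.
  - by move=> x y; rewrite opprB addrA subrK.
  - by rewrite subrr.
  - apply: le_trans ule; rewrite le_eqVlt; apply/orP; left; apply/eqP.
    by apply: eq_integral => z _; congr EFin; rewrite /slack; lra.
have v1 n : lipschitz1 (v n) by have [] := vP n.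
have vD x n : `|v n x| <= D.
  have [_ v0 _] := vP n; rewrite -[v n x]subr0 -v0.
  exact: le_trans (v1 n _ _) (bD _ _).
have bv n : bounded_mfun (v n : bT -> R).
  apply: bounded_continuous_mfun; apply: bounded_continuous_fct.
    exact: lipschitz1_continuous.
  by exists D => x.
pose g x := eventual_sup (v ^~ x).
have g1 x y : g x - g y <= mdist x y.
  rewrite lerBlDl; apply: (@eventual_sup_le _ _ _ D D _ 0) => // n _.
  by rewrite -lerBlDl; apply: le_trans (v1 n x y); exact: ler_norm.
have glip : lipschitz1 g.
  by move=> x y; rewrite ler_norml lerNl opprB g1 metric_sym g1.
have bg : bounded_continuous g.
  apply: bounded_continuous_fct; first exact: lipschitz1_continuous.
  by exists D => x; apply: eventual_sup_norm_le.
exists g; split => //.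
have bmg := bounded_continuous_mfun bg.
rewrite -(integral_diff_slack bmg).
suff -> : (\int[pi]_z (slack g z)%:E = 0)%E by rewrite adde0.
have ms n : measurable_fun setT (fun z : bTT => (slack (v n) z)%:E).
  by apply/measurable_EFinP; have [] := bounded_mfun_slack (bv n).
have s0 n z : (0 <= (slack (v n) z)%:E)%E by rewrite lee_fin slack_ge0.
apply/eqP; rewrite eq_le; apply/andP; split; last first.
  by apply: integral_ge0 => z _; rewrite lee_fin slack_ge0.
(* The integral is at most the inverse of [2 ^ k], and [k < 2 ^ k] turns this into [1 / (k + 1)]. *)
suff h k : (\int[pi]_z (slack g z)%:E <= (k.+1%:R^-1)%:E)%E.
  apply/lee_addgt0Pr => e e0'; rewrite add0e.
  have [k _ /(_ k (leqnn _)) ke] := near_infty_natSinv_lt (PosNum e0').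
  by apply: le_trans (h k) _; rewrite lee_fin ltW.
have gk z : ((slack g z)%:E <= \sum_(0 <= n <oo) (slack (v (n + k)%N) z)%:E)%E.
  have := @nneseries_ge0 R (fun n => (slack (v (n + k)%N) z)%:E) xpredT 0
    (fun n _ _ => s0 _ _).
  set r := (\sum_(0 <= n <oo) _)%E.
  have nr n : ((slack (v (n + k)%N) z)%:E <= r)%E.
    apply: le_trans (nneseries_lim_ge n.+1 _); last by move=> i _ _; exact: s0.
    by rewrite big_nat_recr//= leeDr// sume_ge0.
  (* If the series diverges there is nothing to prove; nonnegativity excludes [-oo]. *)
  move: r nr => [r| |//] nr _; last by rewrite leey.
  rewrite lee_fin /slack.
  (* From index [k] on, each slack is at most the sum [r], that is [v n z.2 <= v n z.1 + (r - d z)];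
     this passes to the eventual supremum. *)
  suff : g z.2 <= g z.1 + (r - mdist z.1 z.2) by lra.
  apply: (@eventual_sup_le _ _ _ D D _ k) => // n kn.
  by have := nr (n - k)%N; rewrite subnK// lee_fin /slack; lra.
apply: (@le_trans _ _ (\int[pi]_z
    (\sum_(0 <= n <oo) (slack (v (n + k)%N) z)%:E))%E).
  apply: ge0_le_integral => //.
  - by move=> z _; rewrite lee_fin slack_ge0.
  - by apply/measurable_EFinP; have [] := bounded_mfun_slack bmg.
  - exact: ge0_emeasurable_sum.
rewrite integral_nneseries//.
apply: (@le_trans _ _ (2 ^ k)%:R^-1%:E).
  have e20 : 0 <= (2 ^ k)%:R^-1 :> R by rewrite invr_ge0.
  apply: le_trans (epsilon_trick0 xpredT e20).
  apply: lee_nneseries => n _; first by move=> _; apply: integral_ge0 => z _.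
  have [_ _ +] := vP (n + k)%N; move=> /le_trans; apply.
  by rewrite lee_fin -invfM -natrM -expnD addnS (addnC k n).
by rewrite lee_fin lef_pV2 ?posrE ?ltr0n ?expn_gt0// ler_nat ltn_expl.
Qed.

End coupling.

End duality.

(** * Optimal coupling and optimal potential *)

Theorem theorem9p1 (R : realType) (T : pmetricType R)
  (T_bounded : bounded_space T)
  (T_lcompact : locally_compact [set: T])
  (T_polish : polish R T)
  (mu nu : probability (borelType T) R) :
  let potentials := [set g : T -> R | bounded_continuous g /\ lipschitz1 g] in
  let S := ereal_sup [set integral_diff mu nu g | g in potentials] in
  let I := ereal_inf [set transport_cost pi | pi in couplings mu nu] in
  [/\ S = I,
      exists2 g, potentials g & integral_diff mu nu g = S &
      exists2 pi, couplings mu nu pi & transport_cost pi = I].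
Proof.
move=> potentials S I.
have T_separable : separable T by have [] := T_polish.
have [L [LP Lmu Lnu Ld]] :=
  exists_marginal_functional mu nu (bounded_fct_mdist T_bounded).
pose pi : probability (borelType (T * T)%type) R :=
  functional_measure T_lcompact T_separable LP Lmu Lnu.
have pi_coupling : couplings mu nu pi.
  move=> A mA; split; first exact: functional_measure1.
  exact: functional_measure2.
(* [pi] and [L] are known to agree only on rectangles, so the cost of [pi] is compared with [L d]
   through step functions. *)
have cost_le : (transport_cost pi <=
    (- upper_integral mu nu (- (fun z : T * T => mdist z.1 z.2)))%:E)%E.
  apply: (@le_trans _ _ (L (fun z => mdist z.1 z.2))%:E).
    apply: (transport_cost_le T_lcompact T_separable LP Lmu Lnu) => //.
    move=> A B mA mB.
    exact: functional_measureX.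
  by rewrite lee_fin.
have [g [bg g1 gE]] :=
  potential_attained T_bounded pi_coupling
    (approximate_potential T_bounded pi_coupling cost_le).
have SE : S = transport_cost pi.
  apply/eqP; rewrite eq_le; apply/andP; split.
    by apply: ge_ereal_sup => _ [u [bu u1] <-]; exact: weak_duality.
  by rewrite -gE; apply: ereal_sup_ubound; exists g.
have IE : I = transport_cost pi.
  apply/eqP; rewrite eq_le; apply/andP; split.
    by apply: ereal_inf_lbound; exists pi.
  (* Weak duality for [pi'], tested on [g], bounds its cost below by the cost of [pi]. *)
  apply: le_ereal_inf_tmp => _ [pi' cpi' <-].
  by rewrite -gE; exact: weak_duality.
split; first by rewrite SE IE.
  by exists g => //; rewrite gE SE.
by exists pi.
Qed.
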